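(* Let $\Omega\subset\mathbb{S}^2$ be a domain (connected open set) with smooth boundary, let $p\in[0,1)\cup(1,3]$, and let $u\in C^\infty(\overline\Omega)$ be a solution of $-\Delta u=u^p$ in $\Omega$, $u>0$ in $\Omega$, $u=0$ on $\partial\Omega$. Let $v=u^{\frac{1-p}{2}}$ and let $\nabla^2 v$ be its covariant Hessian. Suppose that (a) if $0\le p<1$, $\nabla^2 v$ is negative semidefinite at every point of $\Omega$; (b) if $1<p\le 3$, $\nabla^2 v$ is positive semidefinite at every point of $\Omega$. Then the rank of $\nabla^2 v$ is constant in $\Omega$.
   Context: $\mathbb{S}^2$ is the unit sphere with its round metric of curvature $1$, $\Delta$ the Laplace–Beltrami operator, and $\nabla^2 v$ the covariant Hessian, $\nabla^2 v(X,Y)=Y(Xv)-(\nabla_YX)v$, a symmetric bilinear form on each tangent space whose rank and definiteness are frame-independent. *)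

(* Defs.v *)
From HB Require Import structures.
From mathcomp Require Import all_boot all_order all_algebra.
From mathcomp Require Import all_classical all_reals all_analysis.
Set Implicit Arguments. Unset Strict Implicit. Unset Printing Implicit Defensive.
Import Order.TTheory GRing.Theory Num.Theory.
Import numFieldNormedType.Exports.
Local Open Scope classical_set_scope.
Local Open Scope ring_scope.

Section S2.
Variable R : realType.
Notation V := 'rV[R]_3.

Definition dot (x y : V) : R := \sum_(i < 3) x ord0 i * y ord0 i.
Definition enorm (x : V) : R := Num.sqrt (dot x x).

Definition S2 : set V := [set x | dot x x = 1].

Definition tangent (x X : V) : Prop := dot x X = 0.

Definition ebasis (i : 'I_3) : V := \row_j (i == j)%:R.
Definition tproj (x X : V) : V := X - dot x X *: x.

Fixpoint Cn (n : nat) (W : set V) (f : V -> R) : Prop :=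
  match n with
  | 0 => forall x, W x -> {for x, continuous f}
  | n'.+1 => (forall x, W x -> differentiable f x) /\
             forall w : V, Cn n' W ('D_w f)
  end.
Definition Cinf (W : set V) (f : V -> R) : Prop := forall n, Cn n W f.

Definition ext0 (f : V -> R) : V -> R := fun y => f ((enorm y)^-1 *: y).

(* covariant Hessian of f on S^2 at x, evaluated on tangent vectors X, Y.
   For tangent X, Y at x in S^2 it equals D^2 F(x)(X,Y) - <X,Y> <x, grad F(x)>
   for any smooth extension F; for the degree-0 extension the radial derivative
   vanishes, so it is the Euclidean second derivative. *)
Definition hessS2 (f : V -> R) (x X Y : V) : R :=
  'D_X ('D_Y (ext0 f)) x.

(* matrix of the Hessian bilinear form composed with the tangential projection:
   its rank equals the rank of the bilinear form on T_x S^2. *)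
Definition hessS2_mx (f : V -> R) (x : V) : 'M[R]_3 :=
  \matrix_(i, j) hessS2 f x (tproj x (ebasis i)) (tproj x (ebasis j)).

Definition hess_rank (f : V -> R) (x : V) : nat := \rank (hessS2_mx f x).

Definition lapS2 (f : V -> R) (x : V) : R := \tr (hessS2_mx f x).

Definition S2_domain (O : set V) : Prop :=
  O `<=` S2 /\ (exists W : set V, open W /\ O = W `&` S2) /\
  O !=set0 /\ connected O.

(* boundary of O relative to S^2 (closure is taken in R^3; S^2 is closed) *)
Definition S2_boundary (O : set V) : set V := closure O `\` O.

Definition smooth_boundary (O : set V) : Prop :=
  forall x0, S2_boundary O x0 ->
  exists (N : set V) (phi : V -> R),
    open N /\ N x0 /\ Cinf N phi /\
    (forall y, N y -> S2 y -> (O y <-> phi y < 0)) /\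
    (forall y, N y -> S2 y -> phi y = 0 ->
        exists X, tangent y X /\ 'D_X phi y != 0).

Definition smooth_on_closure (O : set V) (u : V -> R) : Prop :=
  exists (W : set V) (U : V -> R),
    open W /\ closure O `<=` W /\ Cinf W U /\
    (forall x, closure O x -> U x = u x).

End S2.

(* Main.v *)
Require Import Defs.
From HB Require Import structures.
From mathcomp Require Import all_boot all_order all_algebra.
From mathcomp Require Import all_classical all_reals all_analysis.
From mathcomp Require Import ring lra.
Set Implicit Arguments. Unset Strict Implicit. Unset Printing Implicit Defensive.
Import Order.TTheory GRing.Theory Num.Theory.
Import numFieldNormedType.Exports.
Local Open Scope classical_set_scope.
Local Open Scope ring_scope.

(** The rank is in fact always 2. Let F be the degree-0 homogeneous extension
    of v to the cone over Omega and b = (1 - p) / 2. The equation for u becomes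
      |y|^2 (F Lap F - A |grad F|^2) = - b,   A = (b - 1) / b,
    so that Lap F does not vanish. Suppose that the Hessian of v is degenerate
    at a point x, with orthonormal tangent frame e1, e2 and null direction e2.
    For all c and d the functions
      s |-> D^2 F (X, X)  at x + s e1,  X = e2 + c s e1 - c s^2 x,
      s |-> D^2 F (X, X)  at x + s e2,  X = e2 + d s e1 - s x,
    say g1 and g2, have constant sign and vanish at s = 0, so that their first
    derivatives vanish and their second derivatives are signed. With c and d optimal, the
    second derivatives of the equation along e2 together with the homogeneity
    relations D_x G = - k G give, with f = D^2 F (e1, e1) and subscripts for
    derivatives of F,
      f (g1'' + g2'') = (2 f / F) ((2 - A) F_2^2 + b) - 2 |grad F|^2 < 0
    both for 0 <= p < 1 (f, A < 0) and for 1 < p <= 3 (f > 0, A >= 2, b < 0),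
    whereas g1'', g2'' and f have the same sign. *)

(** * Local congruence and lines in normed spaces *)

Section NormedSpace.
Variables (R : realType) (V W : normedModType R).
Implicit Types (f g : V -> W) (x v : V).

(** The first-order expansion of [f] at [x] is also one of [g], since only values near [x] enter;
    uniqueness of the differential then identifies ['d g x]. *)
Lemma near_eq_differentiable f g x :
  (\near x, f x = g x) -> differentiable f x -> differentiable g x.
Proof.
move=> fg df; have [dfc dfo] := (diff_locallyP x f).1 df.
have gx : g \o shift x = cst (g x) + 'd f x +o_ 0 id.
  apply/eqaddoP => _/posnumP[e].
  move/eqaddoP : dfo => /(_ e%:num) /(_ [gt0 of e%:num]).
  have fg0 : \forall h \near (0 : V), f (h + x) = g (h + x).
    by move: fg; rewrite (near_shift 0 x) /=; apply: filterS => h /=; rewrite subr0.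
  apply: filterS2 fg0 => h /= fgh.
  rewrite -[(g \o _ - _) h]/(g (h + x) - (g x + 'd f x h)) -fgh.
  by rewrite -(nbhs_singleton fg).
apply/diff_locallyP; have dgf := diff_unique dfc gx.
by rewrite dgf.
Qed.

Lemma is_derive_line f x v (s : R) :
  derivable f (s *: v + x) v ->
  is_derive s 1 (fun t : R => f (t *: v + x)) ('D_v f (s *: v + x)).
Proof.
have E : (fun h : R => h^-1 *:
      ((fun t : R => f (t *: v + x)) (h *: 1 + s) - f (s *: v + x))) =
    (fun h : R => h^-1 *: (f (h *: v + (s *: v + x)) - f (s *: v + x))).
  by apply/funext => h /=; rewrite addrA -scalerDl [_%:A]mulr1.
move=> df; split; first by rewrite /derivable /= E.
by rewrite /derive /= E.
Qed.

End NormedSpace.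

(** * Smooth functions *)

Section Smooth.
Variable R : realType.
Local Notation V := 'rV[R]_3.
Implicit Types (W C : set V) (f g : V -> R) (n : nat) (x v w : V).

(** Calculus rules give derivatives only at points of [W], not as equal functions. Openness turns
    equality on [W] into equality near each point, which differentiation respects; the closure
    lemmas below rest on this. *)
Lemma Cn_eq n W f g : open W -> (forall x, W x -> f x = g x) ->
  Cn n W f -> Cn n W g.
Proof.
move=> oW; elim: n f g => [|n IHn] f g fg /=.
  move=> cf x Wx; have nfg : \near x, f x = g x.
    by near=> y; apply: fg; near: y; exact: open_nbhs_nbhs.
  suff : g y @[y --> x] --> g x by [].
  rewrite -(fg x Wx).
  have : f y @[y --> x] --> f x by exact: cf.
  by move=> fx; apply: cvg_trans fx; exact: (@near_eq_cvg _ _ (nbhs x) _ f g nfg).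
case=> df Df; split=> [x Wx|w].
  apply: (near_eq_differentiable _ (df x Wx)).
  by near=> y; apply: fg; near: y; exact: open_nbhs_nbhs.
apply: IHn (Df w) => x Wx; apply: near_eq_derive.
by near=> y; apply: fg; near: y; exact: open_nbhs_nbhs.
Unshelve. all: by end_near. Qed.

Lemma Cn_S n W f : Cn n.+1 W f -> Cn n W f.
Proof.
elim: n f => [|n IHn] f [df Df].
  by move=> x Wx; apply: differentiable_continuous; exact: df.
by split=> // w; apply: IHn; exact: Df.
Qed.

Lemma Cn_sub n W W' f : W `<=` W' -> Cn n W' f -> Cn n W f.
Proof.
move=> sW; elim: n f => [f cf x Wx|n IHn f [df Df]]; first by apply: cf; exact: sW.
split=> [x Wx|w]; first by apply: df; exact: sW.
by apply: IHn; exact: Df.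
Qed.

Lemma Cn_cst n W (a : R) : open W -> Cn n W (fun=> a).
Proof.
move=> oW; elim: n a => [|n IHn] a /=.
  by move=> x _; exact: (@cst_continuous _ _ a).
split=> [x _|w]; first exact: differentiable_cst.
by apply: (Cn_eq oW _ (IHn 0)) => x _; exact/esym/derive_cst.
Qed.

Lemma CnD n W f g : open W -> Cn n W f -> Cn n W g -> Cn n W (fun x => f x + g x).
Proof.
move=> oW; elim: n f g => [|n IHn] f g /=.
  by move=> cf cg x Wx; exact: continuousD (cf x Wx) (cg x Wx).
move=> [df Df] [dg Dg]; split=> [x Wx|w].
  by apply: differentiableD; [exact: df|exact: dg].
apply: (Cn_eq oW _ (IHn _ _ (Df w) (Dg w))) => x Wx; rewrite deriveD//.
- exact/diff_derivable/df.
- exact/diff_derivable/dg.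
Qed.

Lemma CnM n W f g : open W -> Cn n W f -> Cn n W g -> Cn n W (fun x => f x * g x).
Proof.
move=> oW; elim: n f g => [|n IHn] f g.
  by move=> cf cg x Wx; exact: continuousM (cf x Wx) (cg x Wx).
move=> Cf Cg; have [df Df] := Cf; have [dg Dg] := Cg; split=> [x Wx|w].
  by apply: differentiableM; [exact: df|exact: dg].
have := CnD oW (IHn _ _ (Cn_S Cf) (Dg w)) (IHn _ _ (Cn_S Cg) (Df w)).
apply: (Cn_eq oW) => x Wx; rewrite deriveM//.
- exact/diff_derivable/df.
- exact/diff_derivable/dg.
Qed.

Lemma Cinf_derive W f w : Cinf W f -> Cinf W ('D_w f).
Proof. by move=> Cf n; have [_ +] := Cf n.+1; exact. Qed.

Lemma Cinf_differentiable W f x : Cinf W f -> W x -> differentiable f x.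
Proof. by move=> Cf Wx; have [+ _] := Cf 1%N; exact. Qed.

Lemma Cinf_derivable W f x w : Cinf W f -> W x -> derivable f x w.
Proof. by move=> Cf Wx; exact/diff_derivable/Cinf_differentiable/Wx. Qed.

Lemma Cinf_continuous W f x : Cinf W f -> W x -> {for x, continuous f}.
Proof. by move=> Cf Wx; exact: (Cf 0%N). Qed.

Lemma differentiable_powR f x a : differentiable f x -> 0 < f x ->
  differentiable (fun y => f y `^ a) x.
Proof.
move=> df fx; apply: (@differentiable_comp _ _ _ _ f (fun t : R => t `^ a)) => //.
apply/derivable1_diffP; apply: ex_derive; exact: is_derive1_powR.
Qed.

Lemma derive_powR f x w a : differentiable f x -> 0 < f x ->
  'D_w (fun y => f y `^ a) x = a * f x `^ (a - 1) * 'D_w f x.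
Proof.
move=> df fx; have dp : derivable (fun t : R => t `^ a) (f x) 1.
  by apply: ex_derive; exact: is_derive1_powR.
have dp' : differentiable (fun t : R => t `^ a) (f x) by exact/derivable1_diffP.
rewrite deriveE; last exact: differentiable_powR.
rewrite -[fun y => _]/((fun t : R => t `^ a) \o f) diff_comp//= deriv1E//=.
rewrite -deriveE// powR_derive1 ?in_itv/= ?andbT//.
by rewrite /GRing.scale /= mulrC.
Qed.

(** The induction on [n] ranges over all exponents, since differentiating lowers [a] to [a - 1]. *)
Lemma Cn_powR n W f a : open W -> Cinf W f -> (forall x, W x -> 0 < f x) ->
  Cn n W (fun x => f x `^ a).
Proof.
move=> oW Cf f0; elim: n a => [|n IHn] a.
  move=> x Wx; apply: differentiable_continuous.
  exact: differentiable_powR (Cinf_differentiable Cf Wx) (f0 _ Wx).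
split=> [x Wx|w].
  exact: differentiable_powR (Cinf_differentiable Cf Wx) (f0 _ Wx).
have := CnM oW (CnM oW (Cn_cst n a oW) (IHn (a - 1))) (Cinf_derive w Cf n).
apply: (Cn_eq oW) => x Wx; rewrite derive_powR//; last exact: f0.
exact: Cinf_differentiable Wx.
Qed.

(** * Symmetry of second derivatives *)

Lemma near_parallelogram (P : set V) x (a b : V) : nbhs x P ->
  exists2 h : R, 0 < h &
    forall s t : R, 0 <= s <= h -> 0 <= t <= h -> P (s *: a + (t *: b + x)).
Proof.
move=> /nbhs_ballP[e /= e0 eP].
(* The summand 1 keeps [k] positive even if [a] and [b] vanish, and makes the final bound strict. *)
pose k : R := `|a| + `|b| + 1.
have k0 : 0 < k by rewrite /k ltr_wpDl// addr_ge0.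
exists (e / k); first exact: divr_gt0.
move=> s t /andP[s0 sh] /andP[t0 th]; apply: eP; rewrite -ball_normE /=.
rewrite addrA opprD addrCA subrr addr0 normrN.
apply: (le_lt_trans (ler_normD _ _)); rewrite !normrZ !ger0_norm//.
apply: (@le_lt_trans _ _ (e / k * (`|a| + `|b|))).
  by rewrite mulrDr lerD// ler_wpM2r.
by rewrite -mulrA gtr_pMr// mulrC ltr_pdivrMr// mul1r /k ltrDl.
Qed.

Lemma MVT_is_derive (f df : R -> R) (h : R) : 0 < h ->
  (forall t, 0 <= t <= h -> is_derive t 1 f (df t)) ->
  exists2 c, 0 < c < h & f h - f 0 = df c * h.
Proof.
move=> h0 fdf; have [||c] := @MVT _ f df 0 h h0.
- by move=> t; rewrite in_itv/= => /andP[t0 th]; apply: fdf; rewrite !ltW.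
- apply: derivable_within_continuous => t; rewrite in_itv/= => th.
  by have := fdf t th; case.
rewrite in_itv/= subr0 => /andP[c0 ch] ?; by exists c; rewrite ?c0.
Qed.

(** Two uses of the mean value theorem: along [a] for the difference of [f] across the side
    [h *: b], then along [b] for ['D_a f]. *)
Lemma second_difference W f x (a b : V) (h : R) : Cinf W f -> 0 < h ->
  (forall s t : R, 0 <= s <= h -> 0 <= t <= h -> W (s *: a + (t *: b + x))) ->
  exists s t : R, [/\ 0 <= s <= h, 0 <= t <= h &
    f (h *: a + (h *: b + x)) - f (h *: a + x) - (f (h *: b + x) - f x)
    = 'D_b ('D_a f) (s *: a + (t *: b + x)) * h * h].
Proof.
move=> Cf h0 hW.
have hh : 0 <= h <= h by rewrite ?lexx ?ltW.
have h00 : (0 : R) <= 0 <= h by rewrite lexx ltW.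
pose g (s : R) := f (s *: a + (h *: b + x)) - f (s *: a + x).
pose dg (s : R) := 'D_a f (s *: a + (h *: b + x)) - 'D_a f (s *: a + x).
have [t th|s /andP[s0 sh]] := @MVT_is_derive g dg h h0.
  apply: is_deriveB; apply: is_derive_line; apply: (Cinf_derivable Cf).
    exact: hW.
  by have := hW t 0 th h00; rewrite scale0r add0r.
pose k (t : R) := 'D_a f (t *: b + (s *: a + x)).
pose dk (t : R) := 'D_b ('D_a f) (t *: b + (s *: a + x)).
have [t th|t /andP[t0 th]] := @MVT_is_derive k dk h h0.
  apply: is_derive_line; apply: (Cinf_derivable (Cinf_derive a Cf)).
  by rewrite addrCA; apply: hW => //; rewrite !ltW.
rewrite /g /dg /k /dk !scale0r !add0r addrCA [t *: b + _]addrCA => kE ->.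
by rewrite kE; exists s, t; rewrite !ltW.
Qed.

(** The second difference of [f] is symmetric in [a] and [b], so the two mixed derivatives agree at
    some pair of points arbitrarily close to [x]; continuity carries this to [x]. *)
Lemma derive_comm W f x (a b : V) : open W -> Cinf W f -> W x ->
  'D_a ('D_b f) x = 'D_b ('D_a f) x.
Proof.
move=> oW Cf Wx; apply/eqP; rewrite -subr_eq0; apply/eqP.
set P := 'D_a ('D_b f); set Q := 'D_b ('D_a f).
have cP : P y @[y --> x] --> P x.
  exact: (Cinf_continuous (Cinf_derive a (Cinf_derive b Cf)) Wx).
have cQ : Q y @[y --> x] --> Q x.
  exact: (Cinf_continuous (Cinf_derive b (Cinf_derive a Cf)) Wx).
apply/eqP; rewrite -normr_le0; apply/ler_addgt0Pl => e e0; rewrite addr0.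
have e20 : 0 < e / 2 by rewrite divr_gt0.
move/cvgrPdist_le : cP => /(_ _ e20) nP; move/cvgrPdist_le : cQ => /(_ _ e20) nQ.
have nW : nbhs x W by exact: open_nbhs_nbhs.
have nPQ : nbhs x (W `&` ([set y | `|P x - P y| <= e / 2] `&`
                          [set y | `|Q x - Q y| <= e / 2])).
  by apply: filterI => //; exact: filterI nP nQ.
have [h1 h10 hab] := near_parallelogram a b nPQ.
have [s [t [sh th E1]]] := second_difference Cf h10
  (fun s t sh th => (hab s t sh th).1).
have hba (s' t' : R) : 0 <= s' <= h1 -> 0 <= t' <= h1 -> W (s' *: b + (t' *: a + x)).
  by move=> sh' th'; rewrite addrCA; exact: (hab _ _ th' sh').1.
have [s' [t' [sh' th' E2]]] := second_difference Cf h10 hba.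
have [_ [_ /= HQ]] := hab _ _ sh th.
have [_ [/= HP _]] := hab _ _ th' sh'.
rewrite -(addrCA (s' *: b)) in HP.
have PQ : P (s' *: b + (t' *: a + x)) = Q (s *: a + (t *: b + x)).
  apply: (mulIf (lt0r_neq0 h10)); apply: (mulIf (lt0r_neq0 h10)).
  apply: (etrans (esym E2)); apply: (etrans _ E1); rewrite (addrCA (h1 *: b)).
  move: (f _) (f (h1 *: b + x)) (f (h1 *: a + x)) (f x) => A B C D.
  by ring.
have -> : P x - Q x = P x - P (s' *: b + (t' *: a + x)) -
    (Q x - Q (s *: a + (t *: b + x))).
  by rewrite PQ opprB addrA subrK.
apply: (le_trans (ler_normB _ _)); rewrite (splitr e).
exact: lerD HP HQ.
Qed.

(** * Composition and degree-0 extension *)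

Lemma Cn_sum n W m (F : 'I_m -> V -> R) : open W ->
  (forall i, Cn n W (F i)) -> Cn n W (fun x => \sum_(i < m) F i x).
Proof.
move=> oW; elim: m F => [|m IHm] F CF.
  by apply: (Cn_eq oW _ (Cn_cst n 0 oW)) => x _; rewrite big_ord0.
have := CnD oW (CF ord0) (IHm _ (fun i => CF (lift ord0 i))).
by apply: (Cn_eq oW) => x _; rewrite big_ord_recl.
Qed.

Lemma derive_coord i x w : 'D_w (fun y : V => y ord0 i) x = w ord0 i.
Proof.
have := @derive_mx R V 1 3 id x w (@derivable_id _ _ x w).
by rewrite derive_id => /matrixP/(_ ord0 i); rewrite mxE.
Qed.

Lemma Cn_coord n W i : open W -> Cn n W (fun y : V => y ord0 i).
Proof.
move=> oW; elim: n => [|n IHn].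
  by move=> x _; exact/differentiable_continuous/differentiable_coord.
split=> [x _|w]; first exact: differentiable_coord.
by apply: (Cn_eq oW _ (Cn_cst n (w ord0 i) oW)) => x _; rewrite derive_coord.
Qed.

Lemma Cinf_dot W : open W -> Cinf W (fun y : V => dot y y).
Proof.
by move=> oW n; apply: Cn_sum => // i; apply: CnM => //; exact: Cn_coord.
Qed.

Lemma differentiable_coords (psi : V -> V) x :
  (forall i, differentiable (fun y => psi y ord0 i) x) -> differentiable psi x.
Proof.
move=> dpsi.
have -> : psi = (fun y => \sum_(i < 3) psi y ord0 i *: delta_mx ord0 i).
  by apply/funext => y; exact: row_sum_delta.
have -> : (fun y => \sum_(i < 3) psi y ord0 i *: delta_mx ord0 i) =
    \sum_(i < 3) (fun y => psi y ord0 i *: delta_mx ord0 i : V).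
  by apply/funext => y; rewrite fct_sumE.
by apply: differentiable_sum => i; exact: differentiableZl.
Qed.

Lemma derive_row f x w : differentiable f x ->
  'D_w f x = \sum_(i < 3) w ord0 i * 'D_(delta_mx ord0 i) f x.
Proof.
move=> df; rewrite deriveE// {1}(row_sum_delta w) linear_sum.
by apply: eq_bigr => i _; rewrite linearZ /= deriveE.
Qed.

Lemma derive_comp_coords f (psi : V -> V) x w :
  (forall i, differentiable (fun y => psi y ord0 i) x) ->
  differentiable f (psi x) ->
  'D_w (f \o psi) x = \sum_(i < 3)
     'D_w (fun y => psi y ord0 i) x * 'D_(delta_mx ord0 i) f (psi x).
Proof.
move=> dpsi df; have dp := differentiable_coords dpsi.
rewrite deriveE; last exact: differentiable_comp.
rewrite diff_comp//= -(deriveE w dp) -deriveE// derive_row//.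
apply: eq_bigr => i _; rewrite derive_mx ?mxE//.
exact: diff_derivable.
Qed.

(** By the chain rule a derivative of [f \o psi] is a sum of products of derivatives of the
    coordinates of [psi] with functions ['D_e f \o psi], to which the induction hypothesis
    applies. *)
Lemma Cn_comp n W W' f (psi : V -> V) : open W ->
  (forall i, Cinf W (fun y => psi y ord0 i)) ->
  (forall x, W x -> W' (psi x)) -> Cinf W' f -> Cn n W (f \o psi).
Proof.
move=> oW Cpsi sW; have dpsi x i : W x -> differentiable (fun y => psi y ord0 i) x.
  exact: Cinf_differentiable.
have dcomp g x : Cinf W' g -> W x -> differentiable (g \o psi) x.
  move=> Cg Wx; apply: differentiable_comp.
    by apply: differentiable_coords => i; exact: dpsi.
  exact: (Cinf_differentiable Cg (sW _ Wx)).
elim: n f => [|n IHn] f Cf.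
  by move=> x Wx; exact/differentiable_continuous/dcomp.
split=> [x Wx|w]; first exact: dcomp.
have := @Cn_sum n W 3 (fun i y => 'D_w (fun y => psi y ord0 i) y *
  ('D_(delta_mx ord0 i) f \o psi) y) oW (fun i => CnM oW (Cinf_derive w (Cpsi i) n)
    (IHn _ (Cinf_derive _ Cf))).
apply: (Cn_eq oW) => x Wx; rewrite derive_comp_coords//.
  by move=> i; exact: dpsi.
exact: (Cinf_differentiable Cf (sW _ Wx)).
Qed.

(** * Inner product, radial projection and the cone over a domain *)

Lemma dotC x v : dot x v = dot v x.
Proof. by apply: eq_bigr => i _; rewrite mulrC. Qed.

Lemma dotDl x v w : dot (x + v) w = dot x w + dot v w.
Proof. by rewrite -big_split; apply: eq_bigr => i _; rewrite mxE mulrDl. Qed.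

Lemma dotZl (a : R) x w : dot (a *: x) w = a * dot x w.
Proof. by rewrite mulr_sumr; apply: eq_bigr => i _; rewrite mxE mulrA. Qed.

Lemma dotDr x v w : dot w (x + v) = dot w x + dot w v.
Proof. by rewrite !(dotC w) dotDl. Qed.

Lemma dotZr (a : R) x w : dot w (a *: x) = a * dot w x.
Proof. by rewrite !(dotC w) dotZl. Qed.

Lemma dot_eq0 x : dot x x = 0 -> x = 0.
Proof.
move=> xx0; apply/rowP => i; rewrite mxE; apply/eqP; rewrite -sqrf_eq0 expr2.
move: xx0 => /eqP; rewrite psumr_eq0; last by move=> j _; rewrite -expr2 sqr_ge0.
by move=> /allP /(_ i (mem_index_enum i)).
Qed.

Lemma dot_gt0 x : x != 0 -> 0 < dot x x.
Proof.
move=> x0; rewrite lt_neqAle eq_sym; apply/andP; split.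
  by apply: contraNneq x0 => /dot_eq0 ->.
by apply: sumr_ge0 => i _; rewrite -expr2 sqr_ge0.
Qed.

(** The set on which [ext0 f] depends only on [f] over [O]. It is open in the ambient space when [O]
    is relatively open in the sphere, so ordinary calculus applies there. *)
Definition cone (O : set V) : set V :=
  [set y | 0 < dot y y /\ O ((enorm y)^-1 *: y)].

Lemma enormZ (t : R) x : 0 < t -> enorm (t *: x) = t * enorm x.
Proof.
move=> t0; rewrite /enorm dotZl dotZr mulrA -expr2 sqrtrM ?sqr_ge0//.
rewrite sqrtr_sqr ger0_norm//.
exact: ltW.
Qed.

Lemma enorm_gt0 x : 0 < dot x x -> 0 < enorm x.
Proof. by move=> x0; rewrite /enorm sqrtr_gt0. Qed.

Lemma normalizeZ (t : R) x : 0 < t ->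
  (enorm (t *: x))^-1 *: (t *: x) = (enorm x)^-1 *: x.
Proof.
move=> t0; rewrite enormZ// scalerA invfM mulrAC mulVf ?mul1r//.
exact: lt0r_neq0.
Qed.

Lemma cone_scale O (t : R) x : 0 < t -> cone O x -> cone O (t *: x).
Proof.
move=> t0 [x0 Ox]; split; last by rewrite normalizeZ.
by rewrite dotZl dotZr !mulr_gt0.
Qed.

Lemma sphere_norm x : S2 x -> enorm x = 1.
Proof. by rewrite /S2 /enorm /= => ->; rewrite sqrtr1. Qed.

Lemma cone_sphere O x : O `<=` @S2 R -> O x -> cone O x.
Proof.
move=> OS Ox; have Sx := OS _ Ox; split; first by rewrite Sx.
by rewrite sphere_norm// invr1 scale1r.
Qed.

Lemma normalize_sphere x : 0 < dot x x -> S2 ((enorm x)^-1 *: x).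
Proof.
move=> x0; rewrite /S2 /= dotZl dotZr mulrA -expr2 exprVn /enorm sqr_sqrtr ?ltW// mulVf//.
exact: lt0r_neq0.
Qed.

Lemma open_dot_gt0 : open [set y : V | 0 < dot y y].
Proof.
have -> : [set y : V | 0 < dot y y] = (fun y : V => dot y y) @^-1` [set r | 0 < r] by [].
apply: open_comp => [y _|]; last exact: open_gt.
exact: (Cinf_continuous (Cinf_dot openT)).
Qed.

Lemma Cinf_normalize i :
  Cinf [set y : V | 0 < dot y y] (fun y => ((enorm y)^-1 *: y) ord0 i).
Proof.
move=> n; have oP := open_dot_gt0.
have := CnM oP (Cn_powR n (- 2^-1) oP (Cinf_dot oP) (fun x => id)) (Cn_coord n i oP).
apply: (Cn_eq oP) => x /= x0; rewrite mxE powRN powR12_sqrt//.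
exact: ltW.
Qed.

Lemma open_cone O W : open W -> O = W `&` @S2 R -> open (cone O).
Proof.
move=> oW OE.
have -> : cone O = [set y | 0 < dot y y] `&` (fun y => (enorm y)^-1 *: y) @^-1` W.
  apply/seteqP; split=> [x [x0]|x [x0 Wx]]; first by rewrite OE => -[].
  by split=> //; rewrite OE; split=> //; exact: normalize_sphere.
rewrite openE => x [x0 Wx]; apply: filterI.
  by apply: open_nbhs_nbhs; split=> //; exact: open_dot_gt0.
have dpsi : {for x, continuous (fun y : V => (enorm y)^-1 *: y)}.
  apply/differentiable_continuous/differentiable_coords => i.
  exact: (Cinf_differentiable (Cinf_normalize i)).
by apply: dpsi; exact: open_nbhs_nbhs.
Qed.

(** On the cone [ext0 f] reads [f] only on [O], where [F] agrees with it, so it is [F] composed with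
    the smooth radial projection. *)
Lemma Cinf_ext0 O W (f F : V -> R) : open W -> O `<=` W -> open (cone O) ->
  Cinf W F -> (forall x, O x -> F x = f x) -> Cinf (cone O) (ext0 f).
Proof.
move=> oW OW oC CF Ff n.
have : Cn n (cone O) (F \o (fun y => (enorm y)^-1 *: y)).
  apply: (@Cn_comp n _ W) => // [i k|x [_ /OW]//].
  by apply: Cn_sub (Cinf_normalize i k) => x [].
by apply: (Cn_eq oC) => x [_ Ox]; rewrite /= Ff.
Qed.

(** * Homogeneous functions *)

(** Homogeneity of degree [- k]: the extension [ext0 f] starts at [k = 0] and each derivative raises
    [k] by one. *)
Definition homog (k : nat) C (f : V -> R) :=
  forall (t : R) y, 0 < t -> C y -> f (t *: y) = t ^- k * f y.

(** Differentiate both sides of the homogeneity relation in [y]: the chain rule puts a factor [t] on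
    the left, which is moved into the power on the right. *)
Lemma homog_derive k C f w : open C ->
  (forall (t : R) y, 0 < t -> C y -> C (t *: y)) ->
  (forall y, C y -> differentiable f y) ->
  homog k C f -> homog k.+1 C ('D_w f).
Proof.
move=> oC Cs df hf t y t0 Cy.
have dt i : differentiable (fun z : V => (t *: z) ord0 i) y.
  have -> : (fun z : V => (t *: z) ord0 i) = t \*: (fun z : V => z ord0 i).
    by apply/funext => z; rewrite mxE.
  exact/differentiableZ/differentiable_coord.
have D1 : 'D_w (f \o ( *:%R t)) y = t * 'D_w f (t *: y).
  rewrite derive_comp_coords//; last exact/df/Cs.
  rewrite derive_row ?mulr_sumr; last exact/df/Cs.
  apply: eq_bigr => i _; rewrite mulrA; congr (_ * _).
  have -> : (fun z : V => (t *: z) ord0 i) = t \*: (fun z : V => z ord0 i).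
    by apply/funext => z; rewrite mxE.
  by rewrite deriveZ ?derive_coord//; exact/diff_derivable/differentiable_coord.
have D2 : 'D_w (f \o ( *:%R t)) y = t ^- k * 'D_w f y.
  rewrite -[RHS]deriveZ; last exact/diff_derivable/df.
  apply: near_eq_derive; near=> z; apply: hf => //.
  by near: z; exact: open_nbhs_nbhs.
apply: (mulfI (lt0r_neq0 t0)); rewrite -D1 D2 mulrA; congr (_ * _).
by rewrite exprS invfM mulrA divff ?mul1r// lt0r_neq0.
Unshelve. all: by end_near. Qed.

(** Euler's identity, obtained by differentiating the homogeneity relation at scale [t + 1] with
    respect to [t] at 0. *)
Lemma derive_euler k C f y : open C -> differentiable f y -> homog k C f -> C y ->
  'D_y f y = - k%:R * f y.
Proof.
move=> oC df hf Cy.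
have [] := @is_derive_line R V R f y y 0.
  by rewrite scale0r add0r; exact: diff_derivable.
rewrite scale0r add0r => _ <-.
pose g : R -> R := fun t => t + 1.
have dg : is_derive (0 : R) (1 : R) g 1.
  by rewrite -[X in is_derive _ _ _ X]addr0; apply: is_deriveD.
have g0 : g 0 = 1 by rewrite /g add0r.
have gk0 : (g ^+ k) 0 = 1 by rewrite exprfctE g0 expr1n.
have dV : is_derive (0 : R) (1 : R) (fun t => ((g ^+ k) t)^-1) (- k%:R).
  have dX := is_deriveX k dg.
  split; first by apply: derivableV => //; rewrite gk0 oner_eq0.
  rewrite deriveV ?gk0 ?oner_eq0// expr1n invr1 scaleN1r derive_val g0 expr1n.
  by rewrite mulr1 [_%:A]mulr1.
have d1 : 'D_1 (f y \o* (fun t => ((g ^+ k) t)^-1)) (0 : R) = - k%:R * f y.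
  by rewrite deriveMr// derive_val mulrC.
rewrite -d1; apply: near_eq_derive; near=> t.
rewrite -[X in _ + X]scale1r -scalerDl hf//=; first by rewrite exprfctE.
rewrite -ltrBlDr sub0r; near: t.
by apply: lt_nbhsr; rewrite oppr_lt0.
Unshelve. all: by end_near. Qed.

Definition hessmx f x : 'M[R]_3 :=
  \matrix_(i, j) 'D_(delta_mx ord0 i) ('D_(delta_mx ord0 j) f) x.

Lemma hessE C f x u v : open C -> Cinf C f -> C x ->
  'D_u ('D_v f) x = (u *m hessmx f x *m v^T) ord0 ord0.
Proof.
move=> oC Cf Cx.
have -> : 'D_u ('D_v f) x =
    'D_u (\sum_(j < 3) v ord0 j \*: 'D_(delta_mx ord0 j) f) x.
  apply: near_eq_derive; near=> z; rewrite fct_sumE derive_row//.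
  apply: (Cinf_differentiable Cf); near: z; exact: open_nbhs_nbhs.
rewrite derive_sum; last first.
  by move=> j; apply: derivableZ; exact: (Cinf_derivable (Cinf_derive _ Cf)).
rewrite mxE; apply: eq_bigr => j _; rewrite deriveZ; last first.
  exact: (Cinf_derivable (Cinf_derive _ Cf)).
rewrite derive_row; last exact: (Cinf_differentiable (Cinf_derive _ Cf)).
rewrite !mxE mulrC; congr (_ * _); apply: eq_bigr => i _.
by rewrite mxE.
Unshelve. all: by end_near. Qed.

(** * Second order conditions along lines *)

(** The numbers [a], [b], [c] are the value and the first two derivatives of [g] at 0. Keeping the
    derivative [g1] existential lets jets of long expressions be assembled from [jet2D] and [jet2M],
    leaving only identities for [ring]. *)
Definition jet2 (g : R -> R) (a b c : R) : Prop :=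
  g 0 = a /\ exists2 g1 : R -> R, g1 0 = b /\ is_derive (0 : R) (1 : R) g1 c &
    \forall t \near (0 : R), is_derive t (1 : R) g (g1 t).

Lemma jet2_cst (k : R) : jet2 (fun=> k) k 0 0.
Proof.
split=> //; exists (fun=> 0); first by split=> //; exact: is_derive_cst.
by near=> t; exact: is_derive_cst.
Unshelve. all: by end_near. Qed.

Lemma jet2_id : jet2 id 0 1 0.
Proof.
split=> //; exists (fun=> 1); first by split=> //; exact: is_derive_cst.
by near=> t; exact: is_derive_id.
Unshelve. all: by end_near. Qed.

Lemma jet2D (g h : R -> R) a b c a' b' c' : jet2 g a b c -> jet2 h a' b' c' ->
  jet2 (fun t => g t + h t) (a + a') (b + b') (c + c').
Proof.
move=> [<- [g1 [<- dg1] dg]] [<- [h1 [<- dh1] dh]]; split=> //.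
exists (fun t => g1 t + h1 t); first by split=> //; exact: is_deriveD.
by near=> t; apply: is_deriveD; near: t.
Unshelve. all: by end_near. Qed.

Lemma jet2M (g h : R -> R) a b c a' b' c' : jet2 g a b c -> jet2 h a' b' c' ->
  jet2 (fun t => g t * h t) (a * a') (a * b' + b * a')
    (a * c' + 2 * b * b' + c * a').
Proof.
move=> [<- [g1 [<- dg1] dg]] [<- [h1 [<- dh1] dh]]; split=> //.
have dg0 := nbhs_singleton dg; have dh0 := nbhs_singleton dh.
exists (fun t => g t * h1 t + h t * g1 t).
  split; first by rewrite [h 0 * _]mulrC.
  have := is_deriveD (is_deriveM dg0 dh1) (is_deriveM dh0 dg1).
  move=> /is_derive_eq; apply; rewrite /GRing.scale /=; ring.
by near=> t; apply: is_deriveM; near: t.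
Unshelve. all: by end_near. Qed.

Lemma jet2_uniq (g h : R -> R) a b c a' b' c' : jet2 g a b c -> jet2 h a' b' c' ->
  (\forall t \near (0 : R), g t = h t) -> [/\ a = a', b = b' & c = c'].
Proof.
move=> [<- [g1 [<- dg1] dg]] [<- [h1 [<- dh1] dh]] gh.
have gh1 : \forall t \near (0 : R), g1 t = h1 t.
  (* To compare [g1] and [h1] near 0, the equality is needed near each [t] close to 0. *)
  have gh' : \forall t \near (0 : R), \forall s \near t, g s = h s.
    exact: nbhs_interior.
  near=> t.
  have dgt : is_derive t (1 : R) g (g1 t) by near: t.
  have dht : is_derive t (1 : R) h (h1 t) by near: t.
  rewrite -(@derive_val _ _ _ _ _ _ _ dgt) -(@derive_val _ _ _ _ _ _ _ dht).
  by apply: near_eq_derive; near: t.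
split; [exact: nbhs_singleton gh|exact: nbhs_singleton gh1|].
rewrite -(@derive_val _ _ _ _ _ _ _ dg1) -(@derive_val _ _ _ _ _ _ _ dh1).
exact: near_eq_derive.
Unshelve. all: by end_near. Qed.

(** The point 0 is an interior minimum, so the first derivative vanishes. If [c] were negative, [g1]
    would be negative just to the right of 0, and by the mean value theorem so would [g]. *)
Lemma jet2_ge0 (g : R -> R) a b c : jet2 g a b c -> a = 0 ->
  (\forall t \near (0 : R), 0 <= g t) ->
  b = 0 /\ 0 <= c.
Proof.
move=> [<- [g1 [<- dg1] dg]] g0 gge.
have [/= e e0 /= he] := (nbhs_ballP _ _).1 (filterI dg gge : nbhs (0 : R) _).
have hin t : -e < t < e -> is_derive t (1 : R) g (g1 t) /\ 0 <= g t.
  by move=> te; apply: he; rewrite /ball /= sub0r normrN ltr_norml.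
have g10 : g1 0 = 0.
  have : is_derive (0 : R) (1 : R) g 0.
    apply: (@derive1_at_min _ g (- e) e) => [|t|| t].
    - by lra.
    - by rewrite in_itv/= => /hin[[]].
    - by rewrite in_itv/= oppr_lt0 e0.
    - by rewrite in_itv/= g0 => /hin[].
  move=> d0; have [d1 _] : is_derive (0 : R) (1 : R) g (g1 0) /\ 0 <= g 0.
    by apply: hin; rewrite oppr_lt0 e0.
  by rewrite -(@derive_val _ _ _ _ _ _ _ d1) (@derive_val _ _ _ _ _ _ _ d0).
split=> //; rewrite leNgt; apply/negP => c0.
have [dd dv] := dg1.
have lim1 : (fun h : R => h^-1 *: (g1 (h *: 1 + 0) - g1 0)) @ 0^' --> c.
  by rewrite -dv.
have [/= r r0 hr] := (nbhs_ballP _ _).1 (cvgr_lt _ lim1 _ c0).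
pose h := Num.min (e / 2) (r / 2).
have h0 : 0 < h by rewrite lt_min !divr_gt0.
have he2 : h <= e / 2 by rewrite ge_min lexx.
have hr2 : h <= r / 2 by rewrite ge_min lexx orbT.
have [t th|t /andP[t0 th]] := @MVT_is_derive g g1 h h0.
  by have [|//] := hin t; lra.
have [_] : is_derive h (1 : R) g (g1 h) /\ 0 <= g h by apply: hin; lra.
rewrite g0 subr0 => gh ghE; move: gh; rewrite ghE pmulr_lge0// leNgt => /negP; apply.
have : t^-1 *: (g1 (t *: 1 + 0) - g1 0) < 0.
  apply: hr; last exact: lt0r_neq0.
  by rewrite /ball /= sub0r normrN gtr0_norm//; lra.
rewrite g10 subr0 addr0 [_%:A]mulr1 /GRing.scale /= pmulr_rlt0//.
by rewrite invr_gt0.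
Qed.

Lemma near_line (P : set V) x w : nbhs x P ->
  \forall t \near (0 : R), P (t *: w + x).
Proof.
move=> nP; have : {for (0 : R), continuous (fun t : R => t *: w + x)}.
  apply/differentiable_continuous/derivable1_diffP.
  by have [] := @is_derive_line R V V id x w 0 (@derivable_id _ _ _ _).
by apply; rewrite scale0r add0r.
Qed.

Lemma jet2_line C f x w : open C -> Cinf C f -> C x ->
  jet2 (fun t => f (t *: w + x)) (f x) ('D_w f x) ('D_w ('D_w f) x).
Proof.
move=> oC Cf Cx; split; first by rewrite scale0r add0r.
exists (fun t => 'D_w f (t *: w + x)).
  split; first by rewrite scale0r add0r.
  have := @is_derive_line R V R ('D_w f) x w 0; rewrite scale0r add0r; apply.
  exact: (Cinf_derivable (Cinf_derive _ Cf)).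
near=> t; apply: is_derive_line; apply: (Cinf_derivable Cf).
near: t; apply: near_line; exact: open_nbhs_nbhs.
Unshelve. all: by end_near. Qed.

(* locked, so that unification never unfolds the limit defining a derivative *)
Definition pd : V -> (V -> R) -> V -> R := locked (fun v f => 'D_v f).

Lemma pdE v f : pd v f = 'D_v f.
Proof. by rewrite /pd -lock. Qed.

Lemma Cinf_pd C f w : Cinf C f -> Cinf C (pd w f).
Proof. by rewrite pdE; exact: Cinf_derive. Qed.

Lemma pd_comm C f x a b : open C -> Cinf C f -> C x ->
  pd a (pd b f) x = pd b (pd a f) x.
Proof. by rewrite !pdE; exact: derive_comm. Qed.

Lemma eq_pd C f g w x : open C -> (forall y, C y -> f y = g y) -> C x ->
  pd w f x = pd w g x.
Proof.
move=> oC fg Cx; rewrite !pdE; apply: near_eq_derive; near=> y; apply: fg.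
by near: y; exact: open_nbhs_nbhs.
Unshelve. all: by end_near. Qed.

Lemma pd_comm2 C f x a b : open C -> Cinf C f -> C x ->
  pd a (pd b (pd b f)) x = pd b (pd b (pd a f)) x.
Proof.
move=> oC Cf Cx; rewrite (pd_comm a b oC (Cinf_pd b Cf) Cx).
by apply: (eq_pd _ oC) Cx => y; exact: (pd_comm a b oC Cf).
Qed.

Lemma pd_comb C f x w u v (a b : R) : Cinf C f -> C x ->
  pd (w + (a *: u + b *: v)) f x = pd w f x + a * pd u f x + b * pd v f x.
Proof.
move=> Cf Cx; have df := Cinf_differentiable Cf Cx.
by rewrite !pdE !deriveE// !linearD !linearZ /= addrA.
Qed.

Lemma pd2_comb C f x w u v (a b : R) : open C -> Cinf C f -> C x ->
  let X := w + (a *: u + b *: v) in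
  pd X (pd X f) x = pd w (pd w f) x + a ^+ 2 * pd u (pd u f) x
    + b ^+ 2 * pd v (pd v f) x + 2 * a * pd u (pd w f) x
    + 2 * b * pd v (pd w f) x + 2 * a * b * pd u (pd v f) x.
Proof.
move=> oC Cf Cx X; have cm y z := pd_comm y z oC Cf Cx.
rewrite (pd_comb _ _ _ _ _ (Cinf_pd X Cf) Cx) (cm w X) (cm u X) (cm v X).
rewrite !(pd_comb _ _ _ _ _ (Cinf_pd _ Cf) Cx).
by rewrite (cm w u) (cm w v) (cm v u); ring.
Qed.

Lemma jet2_pd C f x w : open C -> Cinf C f -> C x ->
  jet2 (fun t => f (t *: w + x)) (f x) (pd w f x) (pd w (pd w f) x).
Proof. by rewrite !pdE; exact: jet2_line. Qed.

Lemma homog_pd k C f w : open C ->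
  (forall (t : R) y, 0 < t -> C y -> C (t *: y)) -> Cinf C f ->
  homog k C f -> homog k.+1 C (pd w f).
Proof.
move=> oC Cs Cf; rewrite pdE; apply: homog_derive => // y.
exact: Cinf_differentiable.
Qed.

Lemma pd_euler k C f y : open C -> Cinf C f -> homog k C f -> C y ->
  pd y f y = - k%:R * f y.
Proof.
move=> oC Cf hf Cy; rewrite pdE; apply: (derive_euler oC _ hf Cy).
exact: Cinf_differentiable Cy.
Qed.

Lemma jet2_eq (g : R -> R) a b c a' b' c' : jet2 g a b c ->
  a = a' -> b = b' -> c = c' -> jet2 g a' b' c'.
Proof. by move=> + <- <- <-. Qed.

(** * The contradiction at a degenerate point *)

(* [F0] is the value of [F], [f1] and [f2] its derivatives along [e1] and [e2],
   [f], [m], [P] and [T] are [D1 D1 F], [D1 D1 D2 F], [D1 D1 D2 D2 F] and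
   [D2 D2 D2 D2 F]; [sigma] is the sign of the Hessian. *)
Lemma no_flat_direction (A B sigma F0 f f1 f2 m P T : R) :
  sigma * sigma = 1 -> 0 < sigma * B -> 0 <= sigma * A -> sigma * (2 - A) <= 0 ->
  0 < F0 ->
  F0 * f - A * (f1 ^+ 2 + f2 ^+ 2) = B ->
  f2 * f + F0 * m = 0 ->
  2 * f2 * m + F0 * (P + T) + 2 * A * f2 ^+ 2 + 2 * B = 0 ->
  (forall c, 0 <= sigma * (P + 4 * c * m + 4 * c * f2 + 2 * c ^+ 2 * f)) ->
  (forall d, 0 <= sigma * (T + 4 * d * f1 + 2 * d ^+ 2 * f)) -> False.
Proof.
move=> s1 sB sA s2 F00 e0 e1 e2 hc hd.
(* The equation itself excludes [f = 0]: after multiplication by [sigma], both terms on its right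
   side are signed. *)
have sf : 0 < sigma * f.
  have : 0 < F0 * (sigma * f).
    have -> : F0 * (sigma * f) = sigma * A * (f1 ^+ 2 + f2 ^+ 2) + sigma * B.
      by rewrite -e0; ring.
    by rewrite ltr_wpDl// mulr_ge0// addr_ge0// sqr_ge0.
  by rewrite pmulr_rgt0.
have f0 : f != 0 by apply/eqP => f0; move: sf; rewrite f0 mulr0 ltxx.
(* The chosen [c] and [d] are the critical points of the two quadratics. *)
have H : 0 <= sigma * (P + T - 2 * ((m + f2) ^+ 2 + f1 ^+ 2) / f).
  have := addr_ge0 (hc (- (m + f2) / f)) (hd (- f1 / f)).
  congr (0 <= _); field.
  by [].
(* The factor [F0 ^+ 2] lets [F0 * m] and [F0 * (P + T)] be replaced through the differentiated
   equations without division. *)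
have H2 : 0 <= F0 ^+ 2 * ((P + T) * f - 2 * ((m + f2) ^+ 2 + f1 ^+ 2)).
  rewrite mulr_ge0 ?sqr_ge0//.
  have := mulr_ge0 (ltW sf) H; congr (0 <= _).
  transitivity (sigma * sigma * ((P + T) * f - 2 * ((m + f2) ^+ 2 + f1 ^+ 2))).
    by field.
  by rewrite s1 mul1r.
have mE : F0 * m = - (f2 * f) by apply/eqP; rewrite -addr_eq0 addrC e1.
have SE : F0 * (P + T) = - (2 * f2 * m) - 2 * A * f2 ^+ 2 - 2 * B by lra.
have E : F0 ^+ 2 * ((P + T) * f - 2 * ((m + f2) ^+ 2 + f1 ^+ 2)) =
    - 2 * F0 * f * ((A - 2) * f2 ^+ 2 + B) - 2 * F0 ^+ 2 * (f1 ^+ 2 + f2 ^+ 2).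
  transitivity (f * F0 * (F0 * (P + T)) - 2 * ((F0 * m + F0 * f2) ^+ 2 + (F0 * f1) ^+ 2)).
    by ring.
  rewrite SE.
  transitivity (f * (- (2 * f2 * (F0 * m)) - F0 * (2 * A * f2 ^+ 2 + 2 * B))
      - 2 * ((F0 * m + F0 * f2) ^+ 2 + (F0 * f1) ^+ 2)).
    by ring.
  by rewrite mE; ring.
move: H2; rewrite E leNgt => /negP; apply.
rewrite subr_lt0; apply: (@lt_le_trans _ _ 0); last first.
  apply: mulr_ge0; last by apply: addr_ge0; exact: sqr_ge0.
  by apply: mulr_ge0 => //; exact: sqr_ge0.
have -> : - 2 * F0 * f * ((A - 2) * f2 ^+ 2 + B) =
   - (2 * F0 * ((sigma * f) * (- (sigma * (2 - A)) * f2 ^+ 2 + sigma * B))).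
  transitivity (sigma * sigma * (- 2 * F0 * f * ((A - 2) * f2 ^+ 2 + B))).
    by rewrite s1 mul1r.
  by ring.
rewrite oppr_lt0; apply: mulr_gt0; first exact: mulr_gt0.
apply: mulr_gt0 => //; apply: ltr_wpDl => //.
by apply: mulr_ge0; [rewrite oppr_ge0|exact: sqr_ge0].
Qed.

(* First and second order conditions at [x] for the nonnegative function
   [s |-> sigma * D^2 f (X s, X s)] along the line [x + s e], where
   [X s = w + a s u + b s v] is tangent to the sphere and
   [D^2 f x (w, w) = 0]. *)
Lemma hess_null_test C f (sigma : R) x e w u v (a b : R -> R) (a1 a2 b1 b2 : R) :
  open C -> Cinf C f -> C x ->
  jet2 a 0 a1 a2 -> jet2 b 0 b1 b2 ->
  (forall s, dot (s *: e + x) (w + (a s *: u + b s *: v)) = 0) ->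
  (forall y X, C y -> dot y X = 0 -> 0 <= sigma * pd X (pd X f) y) ->
  pd w (pd w f) x = 0 ->
  sigma * (pd e (pd w (pd w f)) x + 2 * a1 * pd u (pd w f) x
           + 2 * b1 * pd v (pd w f) x) = 0 /\
  0 <= sigma * (pd e (pd e (pd w (pd w f))) x
           + 2 * a1 ^+ 2 * pd u (pd u f) x + 2 * b1 ^+ 2 * pd v (pd v f) x
           + 4 * a1 * pd e (pd u (pd w f)) x + 2 * a2 * pd u (pd w f) x
           + 4 * b1 * pd e (pd v (pd w f)) x + 2 * b2 * pd v (pd w f) x
           + 4 * a1 * b1 * pd u (pd v f) x).
Proof.
move=> oC Cf Cx Ja Jb tX convex null.
have J y z := jet2_pd e oC (Cinf_pd y (Cinf_pd z Cf)) Cx.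
have J2 := jet2_cst (2 : R).
(* The summands follow the expansion of [pd X (pd X f)] in [pd2_comb]. *)
have JH := jet2D (jet2D (jet2D (jet2D (jet2D (J w w) (jet2M (jet2M Ja Ja) (J u u)))
  (jet2M (jet2M Jb Jb) (J v v))) (jet2M (jet2M J2 Ja) (J u w)))
  (jet2M (jet2M J2 Jb) (J v w))) (jet2M (jet2M (jet2M J2 Ja) Jb) (J u v)).
have JS := jet2M (jet2_cst sigma) JH.
have [||h1 h2] := jet2_ge0 JS.
- by rewrite null; ring.
- near=> s; have Cs : C (s *: e + x).
    by near: s; apply: near_line; exact: open_nbhs_nbhs.
  have := convex _ _ Cs (tX s); rewrite (pd2_comb _ _ _ _ _ oC Cf Cs).
  by congr (0 <= _); ring.
split.
  by rewrite -[RHS]h1; ring.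
by apply: le_trans h2 _; rewrite le_eqVlt; apply/orP; left; apply/eqP; ring.
Unshelve. all: by end_near. Qed.

(** The equation is stated on the whole cone in the fixed frame [e1], [e2], [x], so it can be
    differentiated along straight lines; the factor [dot y y] makes it scale invariant. *)
Lemma hess_null_absurd C f (A B sigma : R) e1 e2 x :
  open C -> (forall (t : R) y, 0 < t -> C y -> C (t *: y)) -> Cinf C f ->
  homog 0 C f -> C x -> 0 < f x ->
  dot e1 x = 0 -> dot e2 x = 0 -> dot e1 e2 = 0 ->
  dot e1 e1 = 1 -> dot e2 e2 = 1 -> dot x x = 1 ->
  (forall y, C y -> dot y y * (f y * (pd e1 (pd e1 f) y + pd e2 (pd e2 f) y
      + pd x (pd x f) y)
    - A * (pd e1 f y ^+ 2 + pd e2 f y ^+ 2 + pd x f y ^+ 2)) = B) ->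
  (forall y X, C y -> dot y X = 0 -> 0 <= sigma * pd X (pd X f) y) ->
  sigma * sigma = 1 -> 0 < sigma * B -> 0 <= sigma * A -> sigma * (2 - A) <= 0 ->
  pd e2 (pd e2 f) x = 0 -> False.
Proof.
move=> oC Cs Cf hf Cx fx0 d1x d2x d12 d11 d22 dxx PDE convex s1 sB sA s2 null.
(* Homogeneity reduces every derivative in the radial direction [x] to one of lower order. *)
have h1 w := homog_pd w oC Cs Cf hf.
have h2 w z := homog_pd w oC Cs (Cinf_pd z Cf) (h1 z).
have h3 w z y := homog_pd w oC Cs (Cinf_pd z (Cinf_pd y Cf)) (h2 z y).
have x1 : pd x f x = 0 by rewrite (pd_euler oC Cf hf Cx) oppr0 mul0r.
have x2 w : pd x (pd w f) x = - pd w f x.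
  by rewrite (pd_euler oC (Cinf_pd w Cf) (h1 w) Cx) mulN1r.
have x3 w z : pd x (pd w (pd z f)) x = - 2 * pd w (pd z f) x.
  by rewrite (pd_euler oC (Cinf_pd w (Cinf_pd z Cf)) (h2 w z) Cx).
have x4 w z y : pd x (pd w (pd z (pd y f))) x = - 3 * pd w (pd z (pd y f)) x.
  by rewrite (pd_euler oC (Cinf_pd w (Cinf_pd z (Cinf_pd y Cf))) (h3 w z y) Cx).
have cm w z := pd_comm w z oC Cf Cx.
have cm1 y w z := pd_comm w z oC (Cinf_pd y Cf) Cx.
have c2 w z := pd_comm2 w z oC Cf Cx.
have c3 w z y := pd_comm2 w z oC (Cinf_pd y Cf) Cx.
have Jlin (c : R) : jet2 (fun t => c * t) 0 c 0.
  by apply: jet2_eq (jet2M (jet2_cst c) jet2_id) _ _ _; ring.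
have Jsq (c : R) : jet2 (fun t => - c * t * t) 0 0 (- 2 * c).
  by apply: jet2_eq (jet2M (Jlin (- c)) jet2_id) _ _ _; ring.
(* With [e = 0] the base point stays fixed: this is the fact that a null vector of a semidefinite
   form lies in its kernel. *)
have f12 : pd e1 (pd e2 f) x = 0.
  have tan0 (s : R) : dot (s *: 0 + x) (e2 + ((1 * s) *: e1 + (0 * s) *: x)) = 0.
    rewrite scaler0 add0r !mul0r mul1r scale0r addr0.
    by rewrite dotDr dotZr dotC d2x dotC d1x mulr0 addr0.
  have [s1' _] := hess_null_test oC Cf Cx (Jlin 1) (Jlin 0) tan0 convex null.
  have p0 g : pd 0 g x = 0 by rewrite pdE derive0.
  move: s1'; rewrite p0 => s1'.
  have : sigma * (sigma * (2 * pd e1 (pd e2 f) x)) = 0.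
    by rewrite -[X in _ = X](mulr0 sigma) -s1'; ring.
  by rewrite mulrA s1 mul1r => /eqP; rewrite mulf_eq0 pnatr_eq0 /= => /eqP.
(* The coefficient of [x] is forced by tangency at the moved base point: it cancels [c * s * s]
   here, and [s] in [tan2]. *)
have tan1 (c s : R) : dot (s *: e1 + x) (e2 + ((c * s) *: e1 + (- c * s * s) *: x)) = 0.
  rewrite !(dotDl, dotDr, dotZl, dotZr) d12 d11 dxx d1x !(dotC x) d1x d2x; ring.
have tan2 (d s : R) : dot (s *: e2 + x) (e2 + ((d * s) *: e1 + (-1 * s) *: x)) = 0.
  rewrite !(dotDl, dotDr, dotZl, dotZr) (dotC e2 e1) d12 d22 dxx d2x !(dotC x) d1x d2x.
  ring.
have t1 c := hess_null_test oC Cf Cx (Jlin c) (Jsq c) (tan1 c) convex null.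
have t2 d := hess_null_test oC Cf Cx (Jlin d) (Jlin (-1)) (tan2 d) convex null.
have sI z : sigma * z = 0 -> z = 0.
  by move=> sz; rewrite -[z]mul1r -s1 -mulrA sz mulr0.
have fxx : pd x (pd x f) x = 0 by rewrite x2 x1 oppr0.
(* The first-order conditions, with [c = 0] and then [d = 0], fix two third derivatives. *)
have f122 : pd e1 (pd e2 (pd e2 f)) x = 0.
  have [/sI + _] := t1 0; rewrite f12 => t1'; rewrite -[RHS]t1'; ring.
have f222 : pd e2 (pd e2 (pd e2 f)) x = - 2 * pd e2 f x.
  have [/sI + _] := t2 0; rewrite f12 x2 => t2'.
  by apply/eqP; rewrite -subr_eq0; apply/eqP; rewrite -[RHS]t2'; ring.
have Jf := jet2_pd e2 oC Cf Cx.
have J1 w := jet2_pd e2 oC (Cinf_pd w Cf) Cx.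
have J2 w := jet2_pd e2 oC (Cinf_pd w (Cinf_pd w Cf)) Cx.
have JG w := jet2M (J1 w) (J1 w).
(* This is the jet of [dot y y] at [y = t *: e2 + x], namely of [1 + t * t]. *)
have JN := jet2D (jet2_cst (1 : R)) (jet2M jet2_id jet2_id).
have JE := jet2M JN (jet2D (jet2M Jf (jet2D (jet2D (J2 e1) (J2 e2)) (J2 x)))
  (jet2M (jet2_cst (- A)) (jet2D (jet2D (JG e1) (JG e2)) (JG x)))).
have [|q0 q1 q2] := jet2_uniq JE (jet2_cst B).
  near=> t; have Ct : C (t *: e2 + x).
    by near: t; apply: near_line; exact: open_nbhs_nbhs.
  rewrite -(PDE _ Ct) !(dotDl, dotDr, dotZl, dotZr) d22 dxx (dotC x) d2x /=; ring.
have e21 : pd e2 (pd e1 f) x = 0 by rewrite cm.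
have e2x : pd e2 (pd x f) x = - pd e2 f x by rewrite cm x2.
have e1x : pd e1 (pd x f) x = - pd e1 f x by rewrite cm x2.
have e211 : pd e2 (pd e1 (pd e1 f)) x = pd e1 (pd e1 (pd e2 f)) x by exact: c2.
have e221 : pd e2 (pd e2 (pd e1 f)) x = 0 by rewrite -c2.
have e2xx : pd e2 (pd x (pd x f)) x = 2 * pd e2 f x.
  by rewrite c2 x3 x2; ring.
have e2x2 : pd e2 (pd x (pd e2 f)) x = 0.
  by rewrite (cm1 e2) x3 null mulr0.
have e212 : pd e2 (pd e1 (pd e2 f)) x = 0 by rewrite (cm1 e2).
have e22 z : pd e2 (pd e2 (pd z (pd z f))) x = pd z (pd z (pd e2 (pd e2 f))) x.
  transitivity (pd e2 (pd z (pd z (pd e2 f))) x); last exact: c3.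
  by apply: (eq_pd _ oC) Cx => y Cy; exact: pd_comm2 Cy.
have e22xx : pd e2 (pd e2 (pd x (pd x f))) x = 0.
  by rewrite e22 x4 x3 null !mulr0.
apply: (@no_flat_direction A B sigma (f x) (pd e1 (pd e1 f) x) (pd e1 f x) (pd e2 f x)
  (pd e1 (pd e1 (pd e2 f)) x) (pd e1 (pd e1 (pd e2 (pd e2 f))) x)
  (pd e2 (pd e2 (pd e2 (pd e2 f))) x)) => //.
- by rewrite -[RHS]q0 null fxx x1; ring.
- by rewrite -[RHS]q1 null fxx e21 e2x e211 e2xx f222 x1; ring.
(* The term [2 * B] comes from the second derivative of [dot y y], multiplied by the equation at
   [x]; hence the use of [q0]. *)
- by rewrite -[RHS]q2 -q0 null fxx e21 e2x e211 e2xx f222 x1 e221 e22xx e22; ring.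
- by move=> c; have [_] := t1 c; rewrite f12 fxx x2; congr (0 <= _ * _); ring.
- by move=> d; have [_] := t2 d; rewrite f12 fxx e1x e2x2 e212; congr (0 <= _ * _); ring.
Unshelve. all: by end_near. Qed.

Lemma pd_hessE C f x u v : open C -> Cinf C f -> C x ->
  pd u (pd v f) x = (u *m hessmx f x *m v^T) ord0 ord0.
Proof. by rewrite !pdE; exact: hessE. Qed.

(** * Frames and the matrix of the Hessian *)

Lemma dotE x v : dot x v = x ord0 ord0 * v ord0 ord0
  + x ord0 (lift ord0 ord0) * v ord0 (lift ord0 ord0)
  + x ord0 (lift ord0 (lift ord0 ord0)) * v ord0 (lift ord0 (lift ord0 ord0)).
Proof. by rewrite /dot !big_ord_recl big_ord0 addr0 addrA. Qed.

Lemma mulmx_trE x v : (x *m v^T) ord0 ord0 = dot x v.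
Proof. by rewrite mxE; apply: eq_bigr => i _; rewrite mxE. Qed.

(** The witness is the cross product of [v] and [x], of unit length by Lagrange's identity. The
    matrix with rows [w], [v], [x] is orthogonal, and the trace is invariant under conjugation by
    it. *)
Lemma orthonormal_frame x v : dot x x = 1 -> dot v v = 1 -> dot v x = 0 ->
  exists w, [/\ dot w x = 0, dot w v = 0, dot w w = 1 &
    forall B : 'M[R]_3, \tr B = (w *m B *m w^T) ord0 ord0
      + (v *m B *m v^T) ord0 ord0 + (x *m B *m x^T) ord0 ord0].
Proof.
move=> xx vv vx.
pose i1 : 'I_3 := lift ord0 ord0; pose i2 : 'I_3 := lift ord0 (lift ord0 ord0).
pose cr i j := v ord0 i * x ord0 j - v ord0 j * x ord0 i.
pose w : V := \row_(k < 3) nth 0 [:: cr i1 i2; cr i2 ord0; cr ord0 i1] k.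
have wx : dot w x = 0 by rewrite dotE !mxE /= /cr -/i1 -/i2; ring.
have wv : dot w v = 0 by rewrite dotE !mxE /= /cr -/i1 -/i2; ring.
have ww : dot w w = 1.
  transitivity (dot v v * dot x x - dot v x ^+ 2).
    by rewrite !dotE !mxE /= /cr -/i1 -/i2; ring.
  by rewrite xx vv vx; ring.
exists w; split=> // B.
pose q (k : 'I_3) : V := nth 0 [:: w; v; x] k.
pose Q : 'M[R]_3 := \matrix_k q k.
have QQ : Q *m Q^T = 1%:M.
  apply/matrixP => i j; rewrite !mxE.
  transitivity (dot (q i) (q j)).
    by apply: eq_bigr => k _; rewrite !mxE.
  have vw : dot v w = 0 by rewrite dotC.
  have xw : dot x w = 0 by rewrite dotC.
  have xv : dot x v = 0 by rewrite dotC.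
  by case: i => -[|[|[|//]]] ?; case: j => -[|[|[|//]]] ?.
have -> : \tr B = \tr (Q *m B *m Q^T).
  by rewrite -mulmxA mxtrace_mulC -mulmxA (mulmx1C QQ) mulmx1.
have QE k : (Q *m B *m Q^T) k k = (q k *m B *m (q k)^T) ord0 ord0.
  rewrite !mxE; apply: eq_bigr => j _; rewrite !mxE; congr (_ * _).
  by apply: eq_bigr => l _; rewrite !mxE.
by rewrite /mxtrace !big_ord_recl big_ord0 addr0 !QE addrA.
Qed.

Definition projmx x : 'M[R]_3 := \matrix_i tproj x (ebasis R i).

Lemma dot_ebasis x i : dot x (ebasis R i) = x ord0 i.
Proof.
rewrite /dot (bigD1 i)//= mxE eqxx mulr1 big1 ?addr0// => j ji.
by rewrite mxE eq_sym (negPf ji) mulr0.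
Qed.

Lemma projmxE x : projmx x = 1%:M - x^T *m x.
Proof.
by apply/matrixP => i j; rewrite !mxE big_ord1 !mxE dot_ebasis.
Qed.

Lemma mul_projmx x w : w *m projmx x = tproj x w.
Proof.
rewrite projmxE mulmxBr mulmx1 mulmxA /tproj; congr (_ - _).
by rewrite [w *m x^T]mx11_scalar mulmx_trE mul_scalar_mx dotC.
Qed.

Lemma hessS2_mxE C (f : V -> R) x : open C -> Cinf C (ext0 f) -> C x ->
  hessS2_mx f x = projmx x *m hessmx (ext0 f) x *m (projmx x)^T.
Proof.
move=> oC Cf Cx; apply/matrixP => i j.
rewrite [LHS]mxE /hessS2 (hessE _ _ oC Cf Cx) !mxE.
apply: eq_bigr => k _; rewrite !mxE; congr (_ * _).
by apply: eq_bigr => l _; rewrite !mxE.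
Qed.

(** Projecting to the tangent plane removes from the trace only the second derivative along [x],
    which is zero by Euler's identity. *)
Lemma lapS2E C (f : V -> R) x : open C -> Cinf C (ext0 f) ->
  (forall (t : R) y, 0 < t -> C y -> C (t *: y)) -> homog 0 C (ext0 f) ->
  C x -> S2 x -> lapS2 f x = \tr (hessmx (ext0 f) x).
Proof.
move=> oC Cf Cs hf Cx Sx; rewrite /lapS2 (hessS2_mxE oC Cf Cx).
have PT : (projmx x)^T = projmx x.
  by rewrite projmxE linearB /= trmx1 trmx_mul trmxK.
have xP : x *m projmx x = 0 by rewrite mul_projmx /tproj Sx scale1r subrr.
have PP : projmx x *m projmx x = projmx x.
  by rewrite {1}projmxE mulmxBl mul1mx -mulmxA xP mulmx0 subr0.
have xx : (x *m hessmx (ext0 f) x *m x^T) ord0 ord0 = 0.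
  rewrite -(pd_hessE _ _ oC Cf Cx).
  rewrite (pd_euler oC (Cinf_pd x Cf) (homog_pd x oC Cs Cf hf) Cx).
  by rewrite (pd_euler oC Cf hf Cx) oppr0 mul0r mulr0.
rewrite PT -mulmxA mxtrace_mulC -mulmxA PP projmxE mulmxBr mulmx1 linearB /=.
rewrite mulmxA mxtrace_mulC mulmxA -[RHS]subr0; congr (_ - _).
by rewrite [_ *m x^T]mx11_scalar xx mxtrace_scalar mul0rn.
Qed.

(** * Powers of a positive function *)

Lemma pd_powR C f w x a : Cinf C f -> C x -> 0 < f x ->
  pd w (fun y => f y `^ a) x = a * f x `^ (a - 1) * pd w f x.
Proof.
move=> Cf Cx fx; rewrite !pdE derive_powR//.
exact: Cinf_differentiable Cx.
Qed.

Lemma pd2_powR C f w x a : open C -> Cinf C f -> (forall y, C y -> 0 < f y) ->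
  C x -> pd w (pd w (fun y => f y `^ a)) x =
    a * (f x `^ (a - 1) * pd w (pd w f) x
         + (a - 1) * f x `^ (a - 2) * pd w f x ^+ 2).
Proof.
move=> oC Cf f0 Cx.
have Cp b : Cinf C (fun y => f y `^ b) by move=> n; exact: Cn_powR.
have Cq : Cinf C (fun y => f y `^ (a - 1) * pd w f y).
  by move=> n; apply: CnM => //; [exact: Cp|exact: Cinf_pd].
have pM g h : Cinf C g -> Cinf C h ->
    pd w (fun y => g y * h y) x = g x * pd w h x + h x * pd w g x.
  by move=> Cg Ch; rewrite !pdE; apply: deriveM; exact: Cinf_derivable Cx.
rewrite (@eq_pd C _ (fun y => a * (f y `^ (a - 1) * pd w f y)))//; last first.
  by move=> y Cy; rewrite (pd_powR _ _ Cf Cy (f0 _ Cy)) mulrA.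
rewrite (pM (fun=> a)) ?(pM (fun y => f y `^ (a - 1)))//; last 2 first.
- exact: Cinf_pd.
- by move=> n; exact: Cn_cst.
rewrite (pd_powR _ _ Cf Cx (f0 _ Cx)) [pd w (fun=> a)]pdE [X in _ + _ * X]derive_cst.
by rewrite -(addrA a) -opprD; ring.
Qed.

Lemma hessS2_pd f x v w : hessS2 f x v w = pd v (pd w (ext0 f)) x.
Proof. by rewrite !pdE. Qed.

Lemma homog_ext0 C f : homog 0 C (ext0 f).
Proof. by move=> t y t0 _; rewrite /ext0 normalizeZ// expr0 invr1 mul1r. Qed.

(** The kernel of the 3 by 3 matrix is exactly the line of [x]: the tangential part of a kernel
    vector is null for the quadratic form, hence zero. *)
Lemma hess_rank2 C f x : open C -> Cinf C (ext0 f) -> C x -> S2 x ->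
  (forall X, tangent x X -> X != 0 -> hessS2 f x X X != 0) ->
  hess_rank f x = 2%N.
Proof.
move=> oC Cf Cx Sx H; rewrite /hess_rank; set M := hessS2_mx f x.
have ME : M = projmx x *m hessmx (ext0 f) x *m (projmx x)^T.
  by exact: (hessS2_mxE oC Cf Cx).
have wM w : (w *m M *m w^T) ord0 ord0 = hessS2 f x (tproj x w) (tproj x w).
  by rewrite /hessS2 (hessE _ _ oC Cf Cx) -mul_projmx trmx_mul ME !mulmxA.
have kx : (kermx M :=: x)%MS.
  apply/eqmxP/andP; split.
    apply/row_subP => i; set w := row i (kermx M).
    have wM0 : w *m M = 0 by rewrite -row_mul mulmx_ker row0.
    have tw : tproj x w = 0.
      apply/eqP/negPn/negP => tw; have := H (tproj x w) _ tw.
      rewrite -wM wM0 mul0mx mxE eqxx => /(_ _)/negP; apply=> //.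
      by rewrite /tangent /tproj dotDr -scaleNr dotZr Sx mulr1 subrr.
    have -> : w = dot x w *: x by apply/eqP; rewrite -subr_eq0; apply/eqP.
    exact: scalemx_sub.
  by apply/sub_kermxP; rewrite ME !mulmxA mul_projmx /tproj Sx scale1r subrr !mul0mx.
have xn0 : x != 0.
  apply: contra_eq_neq Sx => ->.
  by rewrite -[X in dot X _](scale0r (0 : V)) dotZl mul0r eq_sym oner_eq0.
have := mxrank_ker M; rewrite kx rank_rV xn0.
by have := rank_leq_row M; case: (\rank M) => [|[|[|[|//]]]].
Qed.

(** Transfers the hypotheses from the sphere to the cone, where second derivatives of the extensions
    have degree -2, and rewrites the equation for [u] as the one for [v] required by
    [hess_null_absurd]. *)
Lemma hessS2_neq0 O W (u U : V -> R) (p sigma : R) :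
  let b := (1 - p) / 2 in let v := fun x => u x `^ b in
  O `<=` @S2 R -> open (cone O) ->
  open W -> O `<=` W -> Cinf W U -> (forall x, O x -> U x = u x) ->
  (forall x, O x -> - lapS2 u x = u x `^ p) -> (forall x, O x -> 0 < u x) ->
  (forall x X, O x -> tangent x X -> 0 <= sigma * hessS2 v x X X) ->
  sigma * sigma = 1 -> 0 < sigma * - b -> 0 <= sigma * ((b - 1) / b) ->
  sigma * (2 - (b - 1) / b) <= 0 ->
  [/\ Cinf (cone O) (ext0 v) & forall x X, O x -> tangent x X -> X != 0 ->
     hessS2 v x X X != 0].
Proof.
move=> b v OS oC oW OW CU Uu PDE u0 convex s1 sB sA s2.
have Cs (t : R) y : 0 < t -> cone O y -> cone O (t *: y) by exact: cone_scale.
have Cu : Cinf (cone O) (ext0 u) := Cinf_ext0 oW OW oC CU Uu.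
have hu : homog 0 (cone O) (ext0 u) := @homog_ext0 _ _.
have hv : homog 0 (cone O) (ext0 v) := @homog_ext0 _ _.
have pu y : cone O y -> 0 < ext0 u y by case=> _ /u0.
have Cv : Cinf (cone O) (ext0 v) by move=> n; exact: Cn_powR.
have h2 f w z : Cinf (cone O) f -> homog 0 (cone O) f ->
    homog 2 (cone O) (pd w (pd z f)).
  by move=> Cf hf; exact: (homog_pd w oC Cs (Cinf_pd z Cf) (homog_pd z oC Cs Cf hf)).
have normalize2 f y w z : Cinf (cone O) f -> homog 0 (cone O) f -> cone O y ->
    pd w (pd z f) ((enorm y)^-1 *: y) = dot y y * pd w (pd z f) y.
  move=> Cf hf Cy; have [y0 _] := Cy.
  rewrite (h2 f w z Cf hf) ?invr_gt0 ?enorm_gt0//.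
  by rewrite exprVn invrK /enorm sqr_sqrtr// ltW.
have coneS y : cone O y -> cone O ((enorm y)^-1 *: y).
  by move=> Cy; apply: (Cs _ _ _ Cy); rewrite invr_gt0 enorm_gt0; case: Cy.
have conv y X : cone O y -> dot y X = 0 -> 0 <= sigma * pd X (pd X (ext0 v)) y.
  move=> Cy yX; have [y0 Oy] := Cy.
  have := convex _ X Oy; rewrite /tangent dotZl yX mulr0 => /(_ erefl).
  by rewrite hessS2_pd normalize2// mulrCA pmulr_rge0.
split=> // x X Ox tX X0; apply/negP => /eqP.
rewrite hessS2_pd.
have Cx := cone_sphere OS Ox; have Sx := OS _ Ox.
set e2 := (enorm X)^-1 *: X => HX.
have e22 : dot e2 e2 = 1 := normalize_sphere (dot_gt0 X0).
have e2x : dot e2 x = 0 by rewrite dotC dotZr tX mulr0.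
have [e1 [e1x e12 e11 tr]] := orthonormal_frame Sx e22 e2x.
have He2 : pd e2 (pd e2 (ext0 v)) x = 0.
  rewrite (pd_hessE _ _ oC Cv Cx) /e2 linearZ /= -scalemxAl -scalemxAr -scalemxAl.
  by rewrite mxE mxE -(pd_hessE _ _ oC Cv Cx) HX !mulr0.
have b0 : b != 0 by apply: contraTneq sB => ->; rewrite oppr0 mulr0 ltxx.
apply: (@hess_null_absurd (cone O) (ext0 v) ((b - 1) / b) (- b) sigma e1 e2 x) => //.
  exact: powR_gt0 (pu _ Cx).
move=> y Cy; have [y0 Oy] := Cy; have py := pu _ Cy.
have lap : dot y y * (pd e1 (pd e1 (ext0 u)) y + pd e2 (pd e2 (ext0 u)) y
    + pd x (pd x (ext0 u)) y) = - ext0 u y `^ p.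
  apply: oppr_inj; rewrite opprK -(PDE _ Oy).
  rewrite (lapS2E oC Cu Cs hu (coneS _ Cy) (normalize_sphere y0)) tr.
  rewrite -!(pd_hessE _ _ oC Cu (coneS _ Cy)) !normalize2//.
  by rewrite !mulrDr.
rewrite !(pd_powR _ _ Cu Cy py) !(pd2_powR _ _ oC Cu pu Cy).
rewrite -[ext0 v y]/(ext0 u y `^ b).
set g := ext0 u y; set q := g `^ (b - 2).
have gD r s : g `^ (r + s) = g `^ r * g `^ s by rewrite powRD // (lt0r_neq0 py) implybT.
have g1 : g `^ (b - 1) = g * q.
  by rewrite -[X in X * q]powRr1 ?ltW// -gD; congr (_ `^ _); ring.
have g2 : g `^ b = g * (g * q).
  by rewrite -g1 -[X in X * _]powRr1 ?ltW// -gD; congr (_ `^ _); ring.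
(* The exponents add up to [2 * b - 1 + p = 0]; this choice of [b] makes the right side of the
   equation for [v] constant. *)
have gp : g * g * g * q * q * g `^ p = 1.
  transitivity (g `^ (b - 1) * g `^ b * g `^ p); first by rewrite g1 g2; ring.
  rewrite -!gD (_ : b - 1 + b + p = 0) ?powRr0// /b.
  by field.
rewrite g1 g2.
set d1 := pd e1 (ext0 u) y; set d2 := pd e2 (ext0 u) y; set d3 := pd x (ext0 u) y.
move: lap; set l1 := pd e1 (pd e1 _) y; set l2 := pd e2 (pd e2 _) y.
set l3 := pd x (pd x _) y => lap.
(* The gradient terms cancel because of the coefficient [(b - 1) / b], leaving only the Laplacian of
   [u]. *)
transitivity (b * (g * g * g * q * q) * (dot y y * (l1 + l2 + l3))); last first.
  by rewrite lap mulrN -/g -[in RHS](mulr1 b) -gp; congr (- _); ring.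
by field.
Qed.

End Smooth.

Theorem theorem5p1 (R : realType) (Omega : set 'rV[R]_3) (p : R)
  (u : 'rV[R]_3 -> R) :
  S2_domain Omega -> smooth_boundary Omega ->
  ((0 <= p < 1) \/ (1 < p <= 3)) ->
  smooth_on_closure Omega u ->
  (forall x, Omega x -> - lapS2 u x = u x `^ p) ->
  (forall x, Omega x -> 0 < u x) ->
  (forall x, S2_boundary Omega x -> u x = 0) ->
  let v := fun x => u x `^ ((1 - p) / 2) in
  ((0 <= p < 1) ->
     forall x, Omega x -> forall X, tangent x X -> hessS2 v x X X <= 0) ->
  ((1 < p <= 3) ->
     forall x, Omega x -> forall X, tangent x X -> 0 <= hessS2 v x X X) ->
  exists r : nat, forall x, Omega x -> hess_rank v x = r.
Proof.
move=> [OS [[W0 [oW0 OE]] _]] _ pP [W [U [oW [OW [CU Uu]]]]] PDE u0 _ v concave convex.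
exists 2%N => x Ox.
have oC := open_cone oW0 OE.
have OcO : Omega `<=` closure Omega := @subset_closure _ _.
suff [sigma [s1 sB sA s2 sH]] : exists sigma : R,
    [/\ sigma * sigma = 1, 0 < sigma * - ((1 - p) / 2),
     0 <= sigma * (((1 - p) / 2 - 1) / ((1 - p) / 2)),
     sigma * (2 - ((1 - p) / 2 - 1) / ((1 - p) / 2)) <= 0 &
     forall x X, Omega x -> tangent x X -> 0 <= sigma * hessS2 v x X X].
  have [Cv Hv] := hessS2_neq0 OS oC oW (subset_trans OcO OW) CU
    (fun x Ox => Uu x (OcO x Ox)) PDE u0 sH s1 sB sA s2.
  apply: (hess_rank2 oC Cv (cone_sphere OS Ox) (OS _ Ox)) => X.
  exact: Hv.
(* The sign [sigma] turns both the concave and the convex case into nonnegativity. *)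
case: pP => pP; [exists (-1)|exists 1].
  have /andP[p0 p1] := pP; have q0 : 0 < 1 - p by lra.
  have E : ((1 - p) / 2 - 1) / ((1 - p) / 2) = - ((1 + p) / (1 - p)).
    by field; rewrite gt_eqF.
  have h0 : 0 <= (1 + p) / (1 - p) by apply: divr_ge0; lra.
  rewrite E; split; [lra|lra|lra|lra|].
  by move=> y X Oy tX; rewrite mulN1r oppr_ge0; exact: concave.
have /andP[p1 p3] := pP; have q0 : 0 < p - 1 by lra.
have E : ((1 - p) / 2 - 1) / ((1 - p) / 2) = (p + 1) / (p - 1).
  have q1 : 1 - p != 0 by rewrite lt_eqF//; lra.
  by field; rewrite q1 gt_eqF.
(* This bound is equivalent to [p <= 3]. *)
have h0 : 2 <= (p + 1) / (p - 1) by rewrite ler_pdivlMr//; lra.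
rewrite E; split; [lra|lra|lra|lra|].
by move=> y X Oy tX; rewrite mul1r; exact: convex.
Qed.
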